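(* For every fixed real $\gamma>1/2$, one has $\Gamma_{2^n}(\Delta_n)\leq\gamma$ for all sufficiently large $n$, and therefore $$\lim_{n\to\infty}\Gamma_{2^n}(\Delta_n)=\frac12 .$$
   Context: For a convex body $K\subset\mathbb{R}^n$ (compact convex set with nonempty interior) and an integer $m\geq1$, $$\Gamma_m(K)=\inf\Big\{\gamma>0:\ \exists\, c_1,\ldots,c_m\in\mathbb{R}^n\ \text{such that}\ K\subseteq\bigcup_{i=1}^m(c_i+\gamma K)\Big\}.$$ $\Delta_n=\{x\in\mathbb{R}^n:\ x_i\geq0 \text{ for all } i,\ \sum_{i=1}^n x_i\leq1\}$. The dimension $n$ is an integer with $n\geq2$. *)

(* Defs.v *)
From HB Require Import structures.
From mathcomp Require Import all_boot all_order all_algebra.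
From mathcomp Require Import all_classical all_reals all_analysis.

Set Implicit Arguments.
Unset Strict Implicit.
Unset Printing Implicit Defensive.

Import Order.TTheory GRing.Theory Num.Theory.
Import numFieldNormedType.Exports.

Local Open Scope classical_set_scope.
Local Open Scope ring_scope.

Definition homothet (R : realType) (n : nat) (c : 'rV[R]_n) (g : R)
    (K : set 'rV[R]_n) : set 'rV[R]_n :=
  [set c + g *: x | x in K].

Definition covering_ratios (R : realType) (n m : nat) (K : set 'rV[R]_n) :
    set R :=
  [set g : R | 0 < g /\ exists c : 'I_m -> 'rV[R]_n,
     K `<=` \bigcup_i homothet (c i) g K].

(* [inf] is real-valued, with the default value 0 on a set that is empty or
   unbounded below. Neither occurs when m >= 1: the ratio 1 is always
   admissible (take c = 0), and 0 is a lower bound. *)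
Definition Gamma (R : realType) (n m : nat) (K : set 'rV[R]_n) : R :=
  inf (covering_ratios m K).

Definition simplex (R : realType) (n : nat) : set 'rV[R]_n :=
  [set x : 'rV[R]_n | (forall i : 'I_n, 0 <= x ord0 i) /\
     \sum_(i < n) x ord0 i <= 1].
Arguments simplex : clear implicits.

(* Main.v *)
Require Import Defs.
From HB Require Import structures.
From mathcomp Require Import all_boot all_order all_algebra.
From mathcomp Require Import zify ring lra.

Set Implicit Arguments.
Unset Strict Implicit.
Unset Printing Implicit Defensive.

Import Order.TTheory GRing.Theory Num.Theory.

(* Upper bound. In barycentric coordinates scaled to a lattice, d = n+1, it
   suffices to find few c in N^d with sum K such that every y in N^d with sum N
   dominates one of them, where K/N is slightly below 1/2. View y as a diagram
   with column heights y_i, i.e. as N cells, and mark the cells of y one at a time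
   in a random order. The vector of the highest marks in each column grows from 0
   to y, so its sum crosses K; at the crossing the last mark can be lowered within
   its column so that the sum is exactly K. Hence, if every marked set M whose
   vector has sum K gets the weight N / C(N, |M|), each diagram y contains sets of
   total weight at least 1. There are at most C(n+m, m) C(K, m) such sets with m
   marks, so by C(K, m) / C(N, m) <= (K/N)^m and the negative binomial series the
   total weight is at most W = N (1 - K/N)^-(n+1). A greedy choice turns this
   fractional cover into a cover with about W ln #{y} members, which is at most
   2^n for large n because 1 - K/N > 1/2 and #{y} <= (N+1)^(n+1).

   Lower bound. The simplex contains C(N+n, n) points of the lattice (1/N) Z^n, a
   translate of its g-multiple contains at most C(G+n, n) with G = floor(g N), and
   for g < 1/2 and N large C(N+n, n) > 2^n C(G+n, n). *)

(** * Sets of cells in a grid, and their column heights *)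

Lemma card_bigcup_le (I T : finType) (P : pred I) (F : I -> {set T}) :
  #|\bigcup_(i | P i) F i| <= \sum_(i | P i) #|F i|.
Proof.
elim/big_rec2: _ => [|i n A _ IH]; first by rewrite cards0.
by rewrite (leq_trans (leq_card_setU _ _)) // leq_add2l.
Qed.

Lemma hockey_stick m n : \sum_(i < n) 'C(i, m) = 'C(n, m.+1).
Proof.
elim: n => [|n IH]; first by rewrite big_ord0.
by rewrite big_ord_recr /= IH binS.
Qed.

Lemma hockey_stick_diag m n : \sum_(i < n) 'C(i + m, m) = 'C(n + m, m.+1).
Proof.
elim: n => [|n IH]; first by rewrite big_ord0 bin_small.
by rewrite big_ord_recr /= IH addSn binS.
Qed.

Section Grid.
Variables d N : nat.
Implicit Types (M : {set 'I_d * 'I_N.+1}) (p : 'I_d * 'I_N.+1).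

(* A set M of grid cells encodes the vector of its column heights [top M]; the
   encoding is many-to-one, and it is the sets M that get counted. *)
Definition top M (i : 'I_d) : nat := \max_(p in M | p.1 == i) (p.2 : nat).+1.

Definition height M : nat := \sum_i top M i.

Lemma top_gt M p : p \in M -> p.2 < top M p.1.
Proof. by move=> pM; apply: (leq_bigmax_cond (F := fun p => _)); rewrite pM /=. Qed.

Lemma topU1 M p i :
  top (p |: M) i = if i == p.1 then maxn p.2.+1 (top M i) else top M i.
Proof.
apply/eqP; rewrite eqn_leq; apply/andP; split.
  apply/bigmax_leqP => q /andP[]; rewrite !inE => /orP[/eqP->|qM] /eqP <-.
    by rewrite eqxx leq_maxl.
  by case: ifP => _; rewrite ?leq_max top_gt // orbT.
have le_top : top M i <= top (p |: M) i.
  apply/bigmax_leqP => q /andP[qM /eqP <-]; apply: top_gt.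
  by rewrite !inE qM orbT.
case: ifP => // /eqP ->; rewrite geq_max; apply/andP; split; last first.
  by apply/bigmax_leqP => q /andP[qM /eqP <-]; apply: top_gt; rewrite !inE qM orbT.
by apply: top_gt; rewrite !inE eqxx.
Qed.

Lemma topS M1 M2 i : M1 \subset M2 -> top M1 i <= top M2 i.
Proof.
move=> /subsetP sM; apply/bigmax_leqP => q /andP[qM /eqP <-].
by apply: top_gt; apply: sM.
Qed.

Lemma height0 : height set0 = 0.
Proof.
by apply: big1 => i _; apply: big1 => p; rewrite inE.
Qed.

Lemma top_witness M i : 0 < top M i ->
  exists2 p, p \in M & p.1 = i /\ (p.2 : nat).+1 = top M i.
Proof.
rewrite /top => t0.
case: (pickP (fun p => (p \in M) && (p.1 == i))) => [p0 hp0|none]; last first.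
  by rewrite big_pred0 in t0.
have : 0 < #|[pred p in M | p.1 == i]| by apply/card_gt0P; exists p0.
case/(eq_bigmax_cond (fun p => (p.2 : nat).+1)) => p /andP[pM /eqP pi] e.
by exists p => //; split.
Qed.

(** Kept in additive form so that no truncated subtraction occurs. *)
Lemma heightU1 M p : top M p.1 <= p.2 ->
  height (p |: M) + top M p.1 = height M + p.2.+1.
Proof.
move=> le_p; rewrite /height (bigD1 p.1) //= (bigD1 p.1 (F := top M)) //=.
rewrite topU1 eqxx (eq_bigr (top M)); last first.
  by move=> i /negbTE ni; rewrite topU1 ni.
lia.
Qed.

Lemma heightU1_id M p : p.2 < top M p.1 -> height (p |: M) = height M.
Proof.
move=> lt_p; apply: eq_bigr => i _; rewrite topU1.
by case: eqP => // ->; apply/maxn_idPr.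
Qed.

Definition tokens (y : 'I_d -> nat) : {set 'I_d * 'I_N.+1} :=
  [set p : 'I_d * 'I_N.+1 | p.2 < y p.1].

(** Turns domination of vectors into inclusion of sets, the form that the crossing argument uses. *)
Lemma sub_tokensE (y : 'I_d -> nat) M :
  (M \subset tokens y) = [forall i, top M i <= y i].
Proof.
apply/subsetP/forallP => [sM i|le_top p pM]; last first.
  by rewrite inE (leq_trans (top_gt pM)).
by apply/bigmax_leqP => p /andP[/sM]; rewrite inE => lt /eqP <-.
Qed.

Lemma card_tokens (y : 'I_d -> nat) :
  (forall i, y i <= N.+1) -> #|tokens y| = \sum_i y i.
Proof.
move=> yN; rewrite -sum1_card.
rewrite (eq_bigl (fun p : 'I_d * 'I_N.+1 => xpredT p.1 && (p.2 < y p.1))); last first.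
  by move=> p; rewrite inE.
rewrite -(pair_big_dep xpredT (fun i (a : 'I_N.+1) => a < y i) (fun _ _ => 1)) /=.
apply: eq_bigr => i _.
by rewrite -(big_ord_widen_cond N.+1 xpredT (fun _ => 1) (yN i)) sum1_card card_ord.
Qed.

Lemma top_tokens (y : 'I_d -> nat) i :
  (forall i, y i <= N.+1) -> top (tokens y) i = y i.
Proof.
move=> yN; apply/eqP; rewrite eqn_leq; apply/andP; split.
  by move: i; apply/forallP; rewrite -sub_tokensE.
case E: (y i) => [//|a].
have aN : a < N.+1 by rewrite -E.
by apply: (@top_gt _ (i, Ordinal aN)); rewrite inE /= E.
Qed.

(** A mark that lifts the height to [K] or beyond must overtop its column. Lowered within that
    column, it stays in the diagram and outside [M], and can bring the height to exactly [K]. *)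
Lemma height_exchange (y : 'I_d -> nat) K M p :
  p \in tokens y -> height M < K <= height (p |: M) ->
  exists2 q, q \in tokens y :\: M & height (q |: M) = K.
Proof.
rewrite inE => py /andP[ltK leK].
have [lt_p|le_p] := ltnP p.2 (top M p.1).
  by move: leK; rewrite heightU1_id // leqNgt ltK.
(* Rows count from 0, so a column reaches height [top M p.1 + (K - height M)] through a mark in the
   row numbered one less. *)
have le_a : top M p.1 + (K - height M).-1 <= p.2.
  by clear py; have := heightU1 le_p; lia.
have aN : top M p.1 + (K - height M).-1 < N.+1 by apply: leq_ltn_trans le_a _.
have hq : height ((p.1, Ordinal aN) |: M) + top M p.1 =
          height M + (top M p.1 + (K - height M).-1).+1.
  exact/(@heightU1 M (p.1, Ordinal aN))/leq_addr.
exists (p.1, Ordinal aN); last by apply/eqP; rewrite -(eqn_add2r (top M p.1)) hq; clear -ltK; lia.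
rewrite !inE /= (leq_ltn_trans le_a py) andbT.
by apply/negP => /top_gt /=; rewrite ltnNge leq_addr.
Qed.

(** The column bound [e] serves the induction on the last nonempty column; the weight estimate takes
    all columns. *)
Definition towers (e m k : nat) : {set {set 'I_d * 'I_N.+1}} :=
  [set M : {set 'I_d * 'I_N.+1} |
     [&& [forall p in M, p.1 < e], #|M| == m & height M == k]].

(* A tower is rebuilt from the tower obtained by deleting the last point of its
   last nonempty column: only that column and the remaining height are lost. *)
Lemma towers_recurrence e m k : e <= d ->
  towers e m.+1 k \subset
  \bigcup_(i : 'I_d | i < e) \bigcup_(k' < k)
    [set (i, inord (top M i + (k - k').-1)) |: M | M in towers i.+1 m k'].
Proof.
move=> ed; apply/subsetP => M; rewrite inE => /and3P[/forall_inP Me /eqP cM /eqP hM].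
have [p0 p0M] : exists p, p \in M by apply/card_gt0P; rewrite cM.
have [p pM pmax] := @arg_maxnP _ p0 (mem M) (fun p => p.1 : nat) p0M.
have [|q qM [q1 q2]] := @top_witness M p.1; first exact: leq_ltn_trans (top_gt pM).
pose M0 := M :\ q.
have MM0 : M = q |: M0 by rewrite setD1K.
(* If the column stayed as high without [q], its top mark would lie in the row of [q], hence be
   [q]. *)
have q1M0 : top M0 q.1 <= q.2.
  rewrite leqNgt; apply/negP => lt_q.
  have [|r] := @top_witness M0 q.1; first exact: leq_ltn_trans lt_q.
  rewrite !inE => /andP[rq rM] [r1 r2].
  have : top M0 q.1 <= top M q.1 by rewrite topS // subsetDl.
  rewrite q1 -q2 -q1 -r2 => le_r.
  have e2 : r.2 = q.2 by apply/val_inj/eqP; rewrite eqn_leq -ltnS le_r -ltnS r2.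
  by case/eqP: rq; case: r q r1 e2 {rM r2 le_r q1 q2 qM MM0 lt_q M0} => [? ?] [? ?] /= -> ->.
have := heightU1 q1M0; rewrite -MM0 hM => hM0.
have ltk : height M0 < k.
  by rewrite -(ltn_add2r (top M0 q.1)) hM0 addnS ltnS leq_add2l.
apply/bigcupP; exists q.1; first exact: Me.
apply/bigcupP; exists (Ordinal ltk) => //.
apply/imsetP; exists M0.
  rewrite inE eqxx andbT; apply/andP; split.
    apply/forall_inP => r; rewrite !inE => /andP[_ rM].
    by rewrite ltnS q1; apply: pmax.
  by move: cM; rewrite MM0 cardsU1 !inE eqxx /=; lia.
rewrite {1}MM0; congr (_ |: _).
rewrite [LHS]surjective_pairing; congr (_, _); apply/val_inj.
have q2E : top M0 q.1 + (k - height M0).-1 = q.2.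
  move: hM0 q1M0 ltk; clear.
  by move: (height M0) (top M0 q.1) (nat_of_ord q.2) => a b c; lia.
by rewrite /= q2E inordK.
Qed.

(** In the recurrence, the sums over the last column and over the remaining height separate into two
    hockey-stick sums. *)
Lemma card_towers (e m k : nat) : e <= d ->
  #|towers e m k| <= 'C((e + m).-1, m) * 'C(k, m).
Proof.
elim: m e k => [|m IH] e k ed.
  rewrite !bin0 muln1 -(cards1 (set0 : {set 'I_d * 'I_N.+1})).
  apply: subset_leq_card; apply/subsetP => M; rewrite !inE.
  by case/and3P=> _ /eqP /cards0_eq ->; rewrite eqxx.
apply: leq_trans (subset_leq_card (towers_recurrence _ _ ed)) _.
apply: leq_trans (card_bigcup_le _ _) _.
apply: (@leq_trans (\sum_(i : 'I_d | i < e) 'C(i + m, m) * 'C(k, m.+1))).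
  apply: leq_sum => i ie; apply: leq_trans (card_bigcup_le _ _) _.
  rewrite -hockey_stick big_distrr /=; apply: leq_sum => k' _.
  by apply: leq_trans (leq_imset_card _ _) _; apply: IH.
rewrite -big_distrl /= leq_mul2r; apply/orP; right.
rewrite -(big_ord_widen d (fun i => 'C(i + m, m)) ed).
by rewrite hockey_stick_diag addnS.
Qed.

End Grid.

(** * The weight of the marked sets contained in a diagram *)

Lemma card_dep_pairs (I T : finType) (A : {set I}) (B : I -> {set T}) c :
  (forall i, i \in A -> #|B i| = c) ->
  #|[set u : I * T | (u.1 \in A) && (u.2 \in B u.1)]| = #|A| * c.
Proof.
move=> Bc; rewrite -sum1_card.
under eq_bigl do rewrite inE.
rewrite -(pair_big_dep (mem A) (fun i => mem (B i)) (fun _ _ => 1)) /=.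
rewrite -sum_nat_const; apply: eq_bigr => i /Bc <-.
by rewrite sum1_card.
Qed.

Section Crossing.
Variables (T : finType) (S : {set T}) (h : {set T} -> nat) (K : nat).

Definition above m := [set M : {set T} | [&& M \subset S, #|M| == m & K <= h M]].
Definition level m := [set M : {set T} | [&& M \subset S, #|M| == m & h M == K]].

Hypothesis exchange : forall (M : {set T}) t, M \subset S -> t \in S ->
  h M < K <= h (t |: M) -> exists2 q, q \in S :\: M & h (q |: M) = K.

(* Count the pairs (M, t) with M above K and t in M: either M :\ t is still
   above K, or t can be exchanged for some q with q |: (M :\ t) exactly at K. *)
Lemma above_step m :
  m.+1 * #|above m.+1| <=
  (#|S| - m) * #|above m| + m.+1 * #|S| * #|level m.+1|.
Proof.
pose P := [set u : {set T} * T | (u.1 \in above m.+1) && (u.2 \in u.1)].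
pose P1 := [set u in P | K <= h (u.1 :\ u.2)].
pose Q1 := [set u : {set T} * T | (u.1 \in above m) && (u.2 \in S :\: u.1)].
pose L := [set u : {set T} * T | (u.1 \in level m.+1) && (u.2 \in u.1)].
pose Q2 := [set u : ({set T} * T) * T | (u.1 \in L) && (u.2 \in S)].
have cP : #|P| = #|above m.+1| * m.+1.
  by apply: (card_dep_pairs (B := fun M : {set T} => M)) => M; rewrite inE => /and3P[_ /eqP].
have cQ1 : #|Q1| = #|above m| * (#|S| - m).
  apply: (card_dep_pairs (B := fun M => S :\: M)) => M.
  by rewrite inE => /and3P[MS /eqP <- _]; rewrite cardsDS.
have cL : #|L| = #|level m.+1| * m.+1.
  by apply: (card_dep_pairs (B := fun M : {set T} => M)) => M; rewrite inE => /and3P[_ /eqP].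
have cQ2 : #|Q2| = #|L| * #|S| by apply: (card_dep_pairs (B := fun=> S)).
have le1 : #|P1| <= #|Q1|.
  rewrite -(@card_in_imset _ _ (fun u => (u.1 :\ u.2, u.2)) P1).
    apply/subset_leq_card/subsetP => _ /imsetP[[M t] + ->] /=.
    rewrite !inE /= => /andP[/andP[/and3P[MS /eqP cM hM] tM] hMt].
    rewrite (subset_trans (subsetDl _ _) MS) hMt eqxx (subsetP MS) //=.
    by move: cM; rewrite (cardsD1 t) tM add1n => -[->]; rewrite eqxx.
  move=> [M t] [M' t']; rewrite !inE /= => /andP[/andP[_ tM] _] /andP[/andP[_ tM'] _].
  by case=> eM et; rewrite -(setD1K tM) eM et setD1K.
pose ex (u : {set T} * T) q := (q \in S :\: (u.1 :\ u.2)) && (h (q |: (u.1 :\ u.2)) == K).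
(* On [P :\: P1], [exchange] supplies such a [q], so the default [u.2] is not reached there. *)
pose sub u := odflt u.2 [pick q | ex u q].
have exP u : u \in P :\: P1 -> ex u (sub u).
  case: u => M t uP; rewrite /sub; case: pickP => [//|none].
  move: uP; rewrite !inE /= => /andP[+ /andP[/and3P[MS cM hM] tM]].
  rewrite MS cM hM tM /= -ltnNge => hMt.
  have [|||q qS /eqP hq] := exchange (M := M :\ t) (t := t).
  - exact: subset_trans (subsetDl _ _) MS.
  - exact: (subsetP MS).
  - by rewrite hMt setD1K.
  by move: (none q); rewrite /ex /= qS hq.
(* Recording [q] and [t] makes the map injective: [q] recovers [M :\ t], then [t] recovers [M].
   Letting [t] range over [S] costs the factor [#|S|]. *)
have le2 : #|P :\: P1| <= #|Q2|.
  rewrite -(@card_in_imset _ _ (fun u => ((sub u |: (u.1 :\ u.2), sub u), u.2)) (P :\: P1)).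
    apply/subset_leq_card/subsetP => _ /imsetP[[M t] uP ->] /=.
    have /andP[] := exP _ uP; rewrite /=; move: (sub (M, t)) => q qS hq.
    move: uP; rewrite !inE /= => /andP[_ /andP[/and3P[MS /eqP cM hM] tM]].
    move: qS; rewrite inE => /andP[qM qS].
    rewrite hq eqxx (subsetP MS t tM) !andbT /=; apply/andP; split.
      rewrite subUset sub1set qS /=; exact: subset_trans (subsetDl _ _) MS.
    by rewrite cardsU1 qM -cM (cardsD1 t M) tM.
  move=> [M t] [M' t'] uP uP' /= [eM eq et].
  have /andP[] := exP _ uP; rewrite /= !inE => /andP[qM _] _.
  have /andP[] := exP _ uP'; rewrite /= !inE => /andP[qM' _] _.
  have eD : M :\ t = M' :\ t'.
    move: eM; rewrite -eq; move: qM qM'; rewrite -eq.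
    move: (sub _) => q qM qM' eM.
    by rewrite -(setU1K (B := M :\ t) (a := q)) ?inE // eM setU1K ?inE.
  have tM : t \in M by move: uP; rewrite !inE /= => /andP[_ /andP[]].
  have tM' : t' \in M' by move: uP'; rewrite !inE /= => /andP[_ /andP[]].
  by rewrite -(setD1K tM) -(setD1K tM') eD et.
have : #|P| <= #|Q1| + #|Q2|.
  have P1P : P1 \subset P by apply/subsetP => u; rewrite inE => /andP[].
  by rewrite -(cardsID P1 P) (setIidPr P1P) leq_add.
rewrite cP cQ1 cQ2 cL; lia.
Qed.

Local Open Scope ring_scope.

(** The left side is the probability that a random [m]-subset of [S] is above [K]. It is 0 for
    [m = 0], and [above_step] divided by [m.+1 * 'C(#|S|, m.+1)] bounds each increment. *)
Lemma above_le_sum (R : realFieldType) m : (m <= #|S|)%N -> (h set0 < K)%N ->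
  #|above m|%:R / 'C(#|S|, m)%:R <=
  \sum_(j < m) #|S|%:R / 'C(#|S|, j.+1)%:R * #|level j.+1|%:R :> R.
Proof.
move=> + h0; elim: m => [_|m IH mS].
  rewrite big_ord0 (_ : above 0 = set0) ?cards0 ?mul0r //.
  apply/setP => M; rewrite !inE; apply/negP => /and3P[_ /eqP/cards0_eq ->].
  by rewrite leqNgt h0.
rewrite big_ord_recr /=; apply: le_trans (lerD (IH (ltnW mS)) (lexx _)).
have key (a b c1 c0 x y z s : R) : 0 < a -> 0 < c1 -> 0 < c0 -> a * c1 = b * c0 ->
    a * x <= b * y + a * s * z -> x / c1 <= y / c0 + s / c1 * z.
  move=> ap c1p c0p e le; rewrite -(ler_pM2l (mulr_gt0 ap c1p)).
  have -> : a * c1 * (x / c1) = a * x by field; rewrite gt_eqF.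
  have -> : a * c1 * (y / c0 + s / c1 * z) = b * y + a * s * z.
    by rewrite mulrDr {1}e; field; rewrite !gt_eqF.
  exact: le.
apply: (key m.+1%:R (#|S| - m)%:R).
- by rewrite ltr0n.
- by rewrite ltr0n bin_gt0.
- by rewrite ltr0n bin_gt0 ltnW.
- by rewrite -!natrM mul_bin_left.
by have := above_step m; rewrite -(ler_nat R) !(natrD, natrM).
Qed.

(** For [m = #|S|] the only subset is [S] itself, which is above [K], so the probability in
    [above_le_sum] is 1. *)
Lemma level_weight (R : realFieldType) : (h set0 < K <= h S)%N ->
  1 <= \sum_(M : {set T} | (M \subset S) && (h M == K))
    #|S|%:R / 'C(#|S|, #|M|)%:R :> R.
Proof.
move=> /andP[h0 hS].
have := above_le_sum R (leqnn _) h0.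
have -> : #|above #|S| | = 1%N.
  rewrite -(cards1 S); congr #|pred_of_set _|; apply/setP => M; rewrite !inE.
  apply/and3P/eqP => [[MS /eqP cM _]|->]; last by rewrite eqxx.
  by apply/eqP; rewrite eqEcard MS cM leqnn.
rewrite binn divr1 => /le_trans -> //.
rewrite (partition_big (fun M : {set T} => inord #|M| : 'I_#|S|.+1) xpredT) //=.
(* The class of size 0 is dropped as nonnegative; the sum in [above_le_sum] starts at size 1. *)
rewrite big_ord_recl /= ler_wpDl //.
  by apply: sumr_ge0 => M _; rewrite divr_ge0.
apply: ler_sum => j _; rewrite -[#|level _|%:R]sumr_const mulr_sumr.
rewrite big_mkcond [leRHS]big_mkcond /=; apply: ler_sum => M _.
rewrite inE; case: and3P => [[MS /eqP cM hM]|_]; last first.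
  by case: ifP => // _; rewrite divr_ge0.
rewrite MS hM cM mulr1 ifT //; apply/eqP/val_inj.
by rewrite /= inordK // ltnS.
Qed.

End Crossing.

Local Open Scope ring_scope.

(** * Elementary estimates *)

Lemma bernoulli_ineq (R : realDomainType) (u : R) n : 0 <= u ->
  1 + u *+ n <= (1 + u) ^+ n.
Proof.
move=> u0; elim: n => [|n IH]; first by rewrite mulr0n addr0 expr0.
rewrite exprS; apply: le_trans (ler_wpM2l _ IH); last by rewrite addr_ge0.
have : 0 <= u * u *+ n by rewrite mulrn_wge0 ?mulr_ge0.
by rewrite mulrS mulrDl mul1r mulrDr mulr1 mulrnAr; lra.
Qed.

(** With [e = d %/ 4], Bernoulli gives [(1 + u) ^+ d >= (u * e) ^+ 4], while [d <= 8 * e] gives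
    [d ^+ 3 <= 512 * e ^+ 3]; a large [e] decides. *)
Lemma cube_le_exp (R : archiRealFieldType) (u C : R) : 0 < u -> 0 <= C ->
  exists d0, forall d, (d0 <= d)%N -> C * d%:R ^+ 3 <= (1 + u) ^+ d.
Proof.
move=> u0 C0.
have [e0 e0P] : exists e0 : nat, C * 512 / u ^+ 4 < e0%:R.
  exists (Num.bound (C * 512 / u ^+ 4)); apply: archi_boundP.
  by rewrite !mulr_ge0 // invr_ge0 exprn_ge0 // ltW.
exists (4 * e0.+1)%N => d dP.
pose e := (d %/ 4)%N.
have e0e : (e0 < e)%N by rewrite /e; lia.
have d8 : (d <= 8 * e)%N by rewrite /e; lia.
have d4 : (e * 4 <= d)%N by rewrite /e; lia.
clearbody e.
have u1 : 1 <= 1 + u by rewrite lerDl ltW.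
apply: (@le_trans _ _ ((u * e%:R) ^+ 4)); last first.
  apply: le_trans (ler_weXn2l u1 d4).
  rewrite exprM lerXn2r ?nnegrE ?mulr_ge0 ?exprn_ge0 ?addr_ge0 ?(ltW u0) //.
  by apply: le_trans (bernoulli_ineq e (ltW u0)); rewrite mulr_natr lerDr.
apply: (@le_trans _ _ (C * (8 * e%:R) ^+ 3)).
  rewrite ler_wpM2l // lerXn2r ?nnegrE ?mulr_ge0 //.
  by rewrite -natrM ler_nat.
rewrite !exprMn (exprS e%:R 3) mulrA mulrA ler_wpM2r ?exprn_ge0 //.
rewrite (_ : 8 ^+ 3 = 512); last by rewrite -natrX.
rewrite ltr_pdivrMr ?exprn_gt0 // in e0P.
by rewrite (le_trans (ltW e0P)) // mulrC ler_wpM2l ?exprn_ge0 ?(ltW u0) // ler_nat ltnW.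
Qed.

(** * Counting lattice points of simplices *)

Lemma ltn_double_ffact n N G j : (2 * G + n < N)%N -> (j < n)%N ->
  (2 ^ j.+1 * (n + G) ^_ j.+1 < (n + N) ^_ j.+1)%N.
Proof.
move=> GN; elim: j => [|j IH] jn; first by rewrite !ffactn1 expn1; lia.
(* The comparison is factor by factor: [2 * (n + G - j.+1) < n + N - j.+1]. *)
rewrite [in leqLHS]ffactnSr (ffactnSr (n + N)) expnSr mulnACA.
apply: ltn_mul; first by apply: IH; apply: ltnW.
lia.
Qed.

Lemma ltn_double_bin n N G : (2 * G + n < N)%N -> (0 < n)%N ->
  (2 ^ n * 'C(n + G, n) < 'C(n + N, n))%N.
Proof.
case: n => // n GN _.
rewrite -(ltn_pmul2r (fact_gt0 n.+1)) -mulnA !bin_ffact.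
exact: ltn_double_ffact.
Qed.

(** The real corner [c] can be replaced by the coordinatewise minimum [m] of [A], which is at least
    [c]. Subtracting [m] injects [A] into the natural tuples of sum at most [G]. *)
Lemma card_lattice_translate (R : realFieldType) n N G (c : 'I_n -> R)
    (A : {set n.-tuple 'I_N.+1}) :
  (forall t k, t \in A -> c k <= (tnth t k)%:R) ->
  (forall t, t \in A -> \sum_k ((tnth t k)%:R - c k) < G.+1%:R) ->
  (#|A| <= 'C(n + G, n))%N.
Proof.
move=> cA sA; have [->|[t0 t0A]] := set_0Vmem A; first by rewrite cards0.
pose m k : nat := tnth [arg min_(t < t0 in A) tnth t k] k.
have m_le t k : t \in A -> (m k <= tnth t k)%N.
  by move=> tA; rewrite /m; case: arg_minnP => // u _; apply.
have c_le k : c k <= (m k)%:R.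
  by rewrite /m; case: arg_minnP => // u uA _; apply: cA.
have sum_le t : t \in A -> (\sum_k (tnth t k - m k) <= G)%N.
  move=> tA; rewrite -ltnS -(ltr_nat R); apply: le_lt_trans (sA _ tA).
  rewrite natr_sum; apply: ler_sum => k _.
  by rewrite natrB ?m_le // lerB.
have le_G t k : t \in A -> (tnth t k - m k <= G)%N.
  move=> tA; apply: leq_trans (sum_le _ tA).
  by rewrite (bigD1 k) //= leq_addr.
pose f (t : n.-tuple 'I_N.+1) : n.-tuple 'I_G.+1 :=
  [tuple inord (tnth t k - m k) | k < n].
rewrite -card_partial_ord_partitions -(@card_in_imset _ _ f A).
  apply/subset_leq_card/subsetP => _ /imsetP[t tA ->].
  rewrite inE big_tuple; apply: leq_trans (sum_le _ tA).
  by apply: leq_sum => k _; rewrite tnth_mktuple inordK // ltnS le_G.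
move=> t t' tA t'A /(congr1 (fun u => tnth u)) eq_f.
apply: eq_from_tnth => k; apply/val_inj.
have := congr1 (fun u => val (u k)) eq_f.
rewrite /= !tnth_mktuple !inordK ?ltnS ?le_G // => eq_k.
by rewrite -(subnK (m_le _ k tA)) eq_k subnK // m_le.
Qed.

Lemma exists_uncovered_tuple n N G (F : 'I_(2 ^ n) -> {set n.-tuple 'I_N.+1}) :
  (0 < n)%N -> (2 * G + n < N)%N -> (forall i, #|F i| <= 'C(n + G, n))%N ->
  exists2 t : n.-tuple 'I_N.+1, (\sum_k tnth t k <= N)%N & forall i, t \notin F i.
Proof.
move=> n0 GN cF.
pose L := [set t : n.-tuple 'I_N.+1 | \sum_(i <- t) i <= N]%N.
have /subsetPn[t] : ~~ (L \subset \bigcup_i F i).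
  apply/negP => /subset_leq_card; rewrite card_partial_ord_partitions leqNgt.
  apply/negP/negPn; apply: leq_ltn_trans (ltn_double_bin GN n0).
  apply: leq_trans (card_bigcup_le _ _) _.
  rewrite -[X in (_ <= X * _)%N]card_ord -sum_nat_const.
  by apply: leq_sum => i _; apply: cF.
rewrite inE big_tuple => tN tF; exists t => // i.
by apply: contra tF => tFi; apply/bigcupP; exists i.
Qed.

(** Trims rounded barycentric coordinates to the exact sum for which a dominated vector is
    available. *)
Lemma leq_sum_truncate n (y : 'I_n -> nat) N : (N <= \sum_i y i)%N ->
  exists2 y' : 'I_n -> nat, (\sum_i y' i = N)%N & forall i, (y' i <= y i)%N.
Proof.
elim: N => [|N IH] Ny; first by exists (fun=> 0%N); rewrite ?big1.
have [y' sy' le_y] := IH (ltnW Ny).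
have [i lt_i] : exists i, (y' i < y i)%N.
  apply/existsP; rewrite -[[exists _, _]]negbK negb_exists; apply/negP => /forallP ge_y.
  move: Ny; rewrite -sy' ltnNge => /negP; apply; apply: leq_sum => i _.
  by rewrite leqNgt.
exists (fun j => if j == i then (y' i).+1 else y' j); last first.
  by move=> j; case: eqP => // ->.
rewrite (bigD1 i) //= eqxx addSn -sy' [in RHS](bigD1 i) //=; congr (_ + _).+1.
by apply: eq_bigr => j /negbTE ->.
Qed.

(** * From fractional covers to covers *)

From mathcomp Require Import reals sequences exp.

(** Factor by factor, [(K - j) / (N - j) <= K / N], with denominators cleared. *)
Lemma leq_bin_exp K N m : (K <= N)%N -> ('C(K, m) * N ^ m <= 'C(N, m) * K ^ m)%N.
Proof.
move=> KN; rewrite -(leq_pmul2l (fact_gt0 m)) !mulnA ![(m`! * _)%N]mulnC !bin_ffact.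
elim: m => [|m IH]; first by rewrite !ffactn0 !expn0.
rewrite !ffactnSr !expnSr mulnACA [leqRHS]mulnACA leq_mul //.
by rewrite !mulnBl mulnC leq_sub2l // leq_mul2l KN orbT.
Qed.

(** Induction on [n]: by Pascal's rule, multiplying the partial sum by [1 - s] yields the one for
    the preceding [n] minus a nonnegative boundary term. *)
Lemma negative_binomial_le (R : realFieldType) (s : R) n L : 0 <= s < 1 ->
  (\sum_(m < L) 'C(n + m, m)%:R * s ^+ m) * (1 - s) ^+ n.+1 <= 1.
Proof.
move=> /andP[s0 s1].
under eq_bigr => m _ do rewrite -bin_sub ?leq_addl // addnK.
elim: n => [|n IH].
  under eq_bigr => m _ do rewrite bin0 mul1r.
  have -> : (\sum_(m < L) s ^+ m) * (1 - s) ^+ 1 = 1 - s ^+ L.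
    by rewrite -[RHS]opprB subrX1; ring.
  by rewrite gerBl exprn_ge0.
apply: le_trans IH; rewrite exprS mulrA ler_wpM2r ?exprn_ge0 ?subr_ge0 ?(ltW s1) //.
have telescope : (\sum_(m < L) 'C(n.+1 + m, n.+1)%:R * s ^+ m) * (1 - s)
     + 'C(n + L, n.+1)%:R * s ^+ L = \sum_(m < L) 'C(n + m, n)%:R * s ^+ m.
  elim: L => [|L IHL]; first by rewrite !big_ord0 mul0r addn0 bin_small ?mul0r ?addr0.
  rewrite !big_ord_recr /= -IHL addnS addSn binS natrD exprS; ring.
by rewrite -telescope lerDl mulr_ge0 ?exprn_ge0.
Qed.

Section FractionalCover.
Variables (R : realType) (T X : finType) (P : pred T) (cov : T -> pred X).
Variables (D : {set X}) (w : T -> R) (W : R).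
Hypotheses (w_ge0 : forall t, 0 <= w t) (W_gt0 : 0 < W).
Hypothesis w_le : \sum_(t | P t) w t <= W.
Hypothesis w_cov : forall x, x \in D -> 1 <= \sum_(t | P t && cov t x) w t.

(** Averaging with the weights [w], some [t] covers at least [#|Y| / W] elements of [Y]; then
    [1 - W^-1 <= expR (- W^-1)]. *)
Lemma greedy_step (t0 : T) (Y : {set X}) : P t0 -> Y \subset D ->
  exists2 t, P t & #|[set x in Y | ~~ cov t x]|%:R <= #|Y|%:R * expR (- W^-1).
Proof.
move=> Pt0 YD.
pose f t := #|[set x in Y | cov t x]|.
have [t Pt tmax] := @arg_maxnP _ t0 P f Pt0.
exists t => //.
have le_max : #|Y|%:R <= W * (f t)%:R.
  apply: (@le_trans _ _ (\sum_(t | P t) w t * (f t)%:R)); last first.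
    apply: le_trans (ler_wpM2r (ler0n _ _) w_le).
    by rewrite mulr_suml; apply: ler_sum => u Pu; rewrite ler_wpM2l // ler_nat; apply: tmax.
  have -> : \sum_(u | P u) w u * (f u)%:R = \sum_(x in Y) \sum_(u | P u && cov u x) w u.
    rewrite (exchange_big_dep P) /= => [|x u _ /andP[] //].
    apply: eq_bigr => u Pu.
    by rewrite Pu sumr_const /= mulr_natr; congr (_ *+ _); apply: eq_card => x; rewrite !inE.
  by rewrite -sumr_const ler_sum // => x xY; rewrite w_cov // (subsetP YD).
have cY : #|[set x in Y | ~~ cov t x]|%:R = #|Y|%:R - (f t)%:R :> R.
  have e1 : #|Y :&: [set x | cov t x]| = f t.
    by rewrite /f; apply: eq_card => x; rewrite !inE.
  have e2 : #|Y :\: [set x | cov t x]| = #|[set x in Y | ~~ cov t x]|.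
    by apply: eq_card => x; rewrite !inE andbC.
  by rewrite -(cardsID [set x | cov t x] Y) e1 e2 natrD; ring.
rewrite cY; apply: (@le_trans _ _ (#|Y|%:R * (1 - W^-1))).
  by rewrite mulrBr mulr1 lerB // ler_pdivrMr // mulrC.
by rewrite ler_wpM2l // expR_ge1Dx.
Qed.

Lemma greedy_cover (t0 : T) k : P t0 -> exists s : seq T,
  [/\ size s = k, all P s &
   #|[set x in D | ~~ has (cov^~ x) s]|%:R <= #|D|%:R * expR (- W^-1) ^+ k].
Proof.
move=> Pt0; elim: k => [|k [s [sk sP IH]]].
  exists [::]; split => //; rewrite expr0 mulr1 ler_nat subset_leq_card //.
  by apply/subsetP => x; rewrite inE => /andP[].
have [|t Pt ht] := @greedy_step t0 [set x in D | ~~ has (cov^~ x) s] Pt0.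
  by apply/subsetP => x; rewrite inE => /andP[].
exists (t :: s); split; rewrite /= ?sk ?Pt //.
apply: (@le_trans _ _ (#|[set x in [set x in D | ~~ has (cov^~ x) s] | ~~ cov t x]|%:R)).
  rewrite ler_nat subset_leq_card //; apply/subsetP => x.
  by rewrite !inE negb_or => /andP[-> /andP[-> ->]].
by rewrite exprSr mulrA (le_trans ht) // ler_wpM2r // expR_ge0.
Qed.

End FractionalCover.

(** * Few vectors dominated by all diagrams *)

Lemma tower_weight (R : realFieldType) n N K : (0 < K < N)%N ->
  \sum_(M : {set 'I_n.+1 * 'I_N.+1} | height M == K) N%:R / 'C(N, #|M|)%:R <=
  N%:R * (1 - K%:R / N%:R) ^- n.+1 :> R.
Proof.
move=> /andP[K0 KN].
have N0 : 0 < N%:R :> R by rewrite ltr0n (ltn_trans K0).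
set s := K%:R / N%:R : R.
have s0 : 0 <= s by rewrite divr_ge0.
have s1 : s < 1 by rewrite ltr_pdivrMr // mul1r ltr_nat.
rewrite (bigID (fun M : {set 'I_n.+1 * 'I_N.+1} => #|M| <= N)%N) /=.
(* Sets with more than [N] marks have weight 0, since their binomial vanishes and [0^-1 = 0]. *)
rewrite [X in _ + X]big1 ?addr0; last first.
  by move=> M /andP[_]; rewrite -ltnNge => ?; rewrite bin_small // invr0 mulr0.
rewrite (partition_big (fun M : {set _} => inord #|M| : 'I_N.+1) xpredT) //=.
apply: (@le_trans _ _ (N%:R * \sum_(m < N.+1) 'C(n + m, m)%:R * s ^+ m)); last first.
  rewrite ler_wpM2l // -[leRHS]mul1r ler_pdivlMr ?exprn_gt0 ?subr_gt0 //.
  by apply: negative_binomial_le; rewrite s0.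
rewrite mulr_sumr; apply: ler_sum => m _.
have mN : (m <= N)%N by rewrite -ltnS.
have C0 : 0 < 'C(N, m)%:R :> R by rewrite ltr0n bin_gt0.
apply: (@le_trans _ _ (#|towers n.+1 N n.+1 m K|%:R * (N%:R / 'C(N, m)%:R))).
  rewrite mulr_natl -sumr_const big_mkcond [leRHS]big_mkcond /=.
  apply: ler_sum => M _; case: ifP => [/andP[/andP[hM cM] /eqP eM]|_]; last first.
    by case: ifP => // _; rewrite divr_ge0.
  have {}cM : #|M| = m by rewrite -eM inordK.
  rewrite inE hM cM eqxx !andbT ifT //.
  by apply/forall_inP => p _.
apply: (@le_trans _ _ (('C(n + m, m) * 'C(K, m))%:R * (N%:R / 'C(N, m)%:R))).
  rewrite ler_wpM2r ?divr_ge0 // ler_nat.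
  by apply: leq_trans (card_towers _ _ _ (leqnn _)) _; rewrite addSn.
have le_s : 'C(K, m)%:R / 'C(N, m)%:R <= s ^+ m.
  rewrite expr_div_n ler_pdivrMr // mulrAC ler_pdivlMr ?exprn_gt0 //.
  by rewrite -!natrX -!natrM ler_nat [leqRHS]mulnC leq_bin_exp // ltnW.
have -> : ('C(n + m, m) * 'C(K, m))%:R * (N%:R / 'C(N, m)%:R) =
    N%:R * ('C(n + m, m)%:R * ('C(K, m)%:R / 'C(N, m)%:R)) :> R.
  by rewrite natrM; ring.
by rewrite !ler_wpM2l.
Qed.

(** The factor [(N * n.+1).+1] exceeds the logarithm of the number of diagrams, because
    [N.+1 <= expR N]. Hence after [k] greedy steps fewer than one diagram, so none, is left
    uncovered. *)
Lemma dominating_family (R : realType) n N K k : (0 < K < N)%N ->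
  (N * n.+1).+1%:R * (N%:R * (1 - K%:R / N%:R) ^- n.+1) <= k%:R :> R ->
  exists s : seq {ffun 'I_n.+1 -> nat},
    [/\ size s = k, forall c : {ffun 'I_n.+1 -> nat}, c \in s -> (\sum_i c i = K)%N &
     forall y : 'I_n.+1 -> nat, (\sum_i y i = N)%N ->
       exists2 c, c \in s & forall i, (c i <= y i)%N].
Proof.
move=> KN; have /andP[K0 ltKN] := KN; set W := N%:R * _ => Wk.
have N0 : 0 < N%:R :> R by rewrite ltr0n (ltn_trans K0).
have W0 : 0 < W.
  by rewrite divr_gt0 // exprn_gt0 // subr_gt0 ltr_pdivrMr // mul1r ltr_nat.
pose D := [set y : {ffun 'I_n.+1 -> 'I_N.+1} | \sum_i y i == N]%N.
pose P (M : {set 'I_n.+1 * 'I_N.+1}) := height M == K.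
pose cov (M : {set 'I_n.+1 * 'I_N.+1}) (y : {ffun 'I_n.+1 -> 'I_N.+1}) := [forall i, top M i <= y i]%N.
pose w (M : {set 'I_n.+1 * 'I_N.+1}) : R := N%:R / 'C(N, #|M|)%:R.
have w_cov (y : {ffun 'I_n.+1 -> 'I_N.+1}) : y \in D -> 1 <= \sum_(M | P M && cov M y) w M.
  rewrite inE => /eqP yN.
  have yN1 i : (y i <= N.+1)%N by rewrite ltnW.
  have ctok : #|tokens N (fun i => y i)| = N by rewrite card_tokens.
  have := @level_weight _ (tokens N (fun i => y i)) (@height _ _) K _ R _.
  rewrite ctok => lw; apply: le_trans (lw _ _) _.
  - move=> M t _; exact: height_exchange.
  - rewrite height0 K0 /= /height; under eq_bigr do rewrite top_tokens //.
    by rewrite yN ltnW.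
  rewrite le_eqVlt; apply/orP; left; apply/eqP; apply: eq_bigl => M.
  by rewrite sub_tokensE andbC.
have full : exists y : {ffun 'I_n.+1 -> 'I_N.+1}, y \in D.
  exists [ffun i => if i == ord0 then ord_max else ord0]; rewrite inE.
  rewrite (bigD1 ord0) //= ffunE eqxx big1 ?addn0 // => i /negbTE i0.
  by rewrite ffunE i0.
have [M0 PM0] : exists M, P M.
  case: full => y /w_cov; case: (pickP P) => [M PM _|none]; first by exists M.
  by rewrite big_pred0 ?ler10 // => M; rewrite none.
have [s [sk sP sc]] := @greedy_cover R _ _ P cov D w W
  (fun t => divr_ge0 (ler0n _ _) (ler0n _ _)) W0 (tower_weight R n KN) w_cov M0 k PM0.
have /eqP : #|[set x in D | ~~ has (cov^~ x) s]| = 0%N.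
  apply/eqP; rewrite -leqn0 -ltnS -(ltr_nat R); apply: le_lt_trans sc _.
  have cD : #|D|%:R <= expR N%:R ^+ n.+1 :> R.
    apply: (@le_trans _ _ (N.+1 ^ n.+1)%:R).
      by rewrite ler_nat (leq_trans (max_card _)) // card_ffun !card_ord.
    by rewrite natrX lerXn2r ?nnegrE ?expR_ge0 // -natr1 addrC expR_ge1Dx.
  apply: le_lt_trans (ler_wpM2r _ cD) _; first by rewrite exprn_ge0 // expR_ge0.
  rewrite -!expRM_natl -expRD -[ltRHS]expR0 ltr_expR.
  rewrite mulrN subr_lt0 -natrM.
  rewrite ltr_pdivlMr //; apply: lt_le_trans Wk.
  by rewrite ltr_pM2r // ltr_nat mulnC.
rewrite cards_eq0 => /eqP empty.
exists [seq [ffun i => top M i] | M <- s]; split.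
- by rewrite size_map.
- move=> _ /mapP[M Ms ->]; under eq_bigr do rewrite ffunE.
  by apply/eqP; apply: (allP sP).
move=> y yN.
have yN1 i : (y i < N.+1)%N by rewrite ltnS -yN (bigD1 i) //= leq_addr.
pose y' : {ffun 'I_n.+1 -> 'I_N.+1} := [ffun i => Ordinal (yN1 i)].
have : y' \notin [set x in D | ~~ has (cov^~ x) s] by rewrite empty inE.
rewrite !inE; under eq_bigr do rewrite ffunE.
rewrite yN eqxx negbK => /hasP[M Ms /forallP le_y].
exists [ffun i => top M i]; first by apply/mapP; exists M.
by move=> i; have := le_y i; rewrite !ffunE.
Qed.

(** * Covering the simplex *)

From mathcomp Require Import all_classical all_reals all_analysis.
Import numFieldNormedType.Exports.

Local Open Scope classical_set_scope.
Local Open Scope ring_scope.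

(** If the barycentric coordinates of [x] dominate [c / A], the remainder has total mass
    [1 - K / A <= g], so [x] lies in the [g]-homothet at [c / A]. *)
Lemma covering_ratios_dominating (R : realType) n N K (g : R) :
  (0 < K < N)%N -> 0 < g -> 1 - g <= K%:R / (N + n.+1)%:R ->
  (N * n.+1).+1%:R * (N%:R * (1 - K%:R / N%:R) ^- n.+1) <= (2 ^ n)%:R :> R ->
  covering_ratios (2 ^ n) (simplex R n) g.
Proof.
move=> KN g0 gK small; split=> //.
have [s [ss sK s_dom]] := dominating_family KN small.
set A := (N + n.+1)%:R in gK.
have A0 : 0 < A by rewrite ltr0n addnS.
(* Coordinate 0 is the barycentric slack and is dropped from the centres. *)
exists (fun j => \row_i ((nth [ffun=> 0%N] s j (lift ord0 i))%:R / A)).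
move=> x [x0 x1].
pose b (i : 'I_n.+1) := if unlift ord0 i is Some j then x ord0 j else 1 - \sum_j x ord0 j.
have b0 : b ord0 = 1 - \sum_j x ord0 j by rewrite /b unlift_none.
have bS j : b (lift ord0 j) = x ord0 j by rewrite /b liftK.
have b_ge0 i : 0 <= b i by rewrite /b; case: unlift => [j|]; rewrite ?subr_ge0.
have sum_b : \sum_i b i = 1.
  by rewrite big_ord_recl b0 (eq_bigr _ (fun j _ => bS j)) subrK.
pose y i := Num.truncn (A * b i).
have yP i : (y i)%:R <= A * b i < (y i).+1%:R by rewrite truncn_itv // mulr_ge0 // ltW.
(* Rounding down loses at most 1 in each of the [n.+1] coordinates, whence [A = N + n.+1]. *)
have Ny : (N <= \sum_i y i)%N.
  rewrite -(leq_add2r n.+1) -(ler_nat R) -/A.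
  have -> : A = \sum_i A * b i by rewrite -mulr_sumr sum_b mulr1.
  rewrite -[X in (_ + X)%:R]card_ord -sum1_card -big_split natr_sum.
  by apply: ler_sum => i _ /=; rewrite addn1 ltW //; have /andP[] := yP i.
have [y' sy' le_y] := leq_sum_truncate Ny.
have [c cs le_c] := s_dom _ sy'.
have cb i : (c i)%:R / A <= b i.
  rewrite ler_pdivrMr // mulrC; have /andP[+ _] := yP i; apply: le_trans.
  by rewrite ler_nat (leq_trans (le_c i)).
have j_lt : (index c s < 2 ^ n)%N by rewrite -ss index_mem.
exists (Ordinal j_lt) => //=; rewrite nth_index //.
exists (g^-1 *: (x - \row_i ((c (lift ord0 i))%:R / A))); last first.
  by rewrite scalerA mulfV ?gt_eqF // scale1r addrC subrK.
split=> [i|].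
  by rewrite !mxE mulr_ge0 ?invr_ge0 ?(ltW g0) // subr_ge0 -bS.
under eq_bigr do rewrite !mxE.
rewrite -mulr_sumr mulrC ler_pdivrMr // mul1r.
apply: le_trans (_ : 1 - K%:R / A <= _); last by rewrite lerBlDl -lerBlDr.
have -> : K%:R / A = \sum_i (c i)%:R / A by rewrite -mulr_suml -natr_sum sK.
rewrite big_ord_recl sumrB opprD addrA lerB //.
by have := cb ord0; rewrite b0; lra.
Qed.

Lemma covering_ratios_near (R : realType) (g : R) : 1 / 2 < g ->
  \forall n \near \oo, covering_ratios (2 ^ n) (simplex R n) g.
Proof.
move=> g12; have eps0 : 0 < g - 1 / 2 by lra.
have [p pP] : exists p : nat, 3 / (g - 1 / 2) < p%:R.
  by exists (Num.bound (3 / (g - 1 / 2))); apply: archi_boundP; rewrite divr_ge0 // ltW.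
pose q := p.+1.
have q0 : 0 < q%:R :> R by rewrite ltr0n.
have u0 : 0 < q.+1%:R^-1 :> R by rewrite invr_gt0.
(* The constant covers [(2 * x * d ^+ 2 + 1) * (4 * x * d) <= 12 * x ^+ 2 * d ^+ 3], where
   [x = q.+1] and [d = n.+1]. *)
have [d0 d0P] := @cube_le_exp R q.+1%:R^-1 (12 * q.+1%:R ^+ 2) u0
  (mulr_ge0 (ler0n _ _) (exprn_ge0 _ (ler0n _ _))).
exists d0 => // n /= d0n.
have := d0P n.+1 (leq_trans d0n (leqnSn _)).
set x := q.+1%:R; set d := n.+1%:R => grow.
have x1 : 1 <= x by rewrite ler1n.
have d1 : 1 <= d by rewrite ler1n.
have xE : x = q%:R + 1 by rewrite /x -natr1.
have qp : p%:R <= q%:R :> R by rewrite ler_nat.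
have NE : (2 * q.+1 * n.+1)%:R = 2 * x * d :> R by rewrite !natrM.
have KE : (q * n.+1)%:R = q%:R * d :> R by rewrite natrM.
(* This choice gives [K / (N + n.+1) = q / (2 * q + 3)], close to 1/2, and
   [1 - K / N = (1 + x^-1) / 2], whose excess over 1/2 gains an exponential factor. *)
apply: (@covering_ratios_dominating _ _ (2 * q.+1 * n.+1) (q * n.+1)).
- by rewrite muln_gt0 /= ltn_pmul2r //; lia.
- lra.
- rewrite natrD NE KE -/d.
  have -> : q%:R * d / (2 * x * d + d) = q%:R / (2 * x + 1).
    by rewrite -[X in _ + X]mul1r -mulrDl -mulf_div divff ?mulr1 // gt_eqF //; lra.
  have := pP; rewrite ltr_pdivrMr // ler_pdivlMr; last by lra.
  move=> pP'; have : p%:R * (g - 1 / 2) <= q%:R * (g - 1 / 2) by rewrite ler_wpM2r // ltW.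
  nra.
have -> : 1 - (q * n.+1)%:R / (2 * q.+1 * n.+1)%:R = (1 + x^-1) / 2 :> R.
  rewrite NE KE (_ : q%:R = x - 1); last by rewrite xE addrK.
  by field; rewrite !gt_eqF //; lra.
rewrite -natr1 natrM NE -/d expr_div_n invf_div natrX exprSr.
set E := (1 + _) ^+ _ in grow *.
have d3 : 1 <= x * d ^+ 2 by rewrite mulr_ege1 // exprn_ege1.
have E0 : 0 < E by rewrite exprn_gt0 // addr_gt0.
have -> : (2 * x * d * d + 1) * (2 * x * d * (2 ^+ n * 2 / E)) =
    2 ^+ n * ((2 * x * d * d + 1) * (4 * x * d) / E) by field; rewrite gt_eqF.
rewrite -[leRHS]mulr1 ler_wpM2l ?exprn_ge0 // ler_pdivrMr // mul1r.
apply: le_trans grow.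
have -> : 12 * x ^+ 2 * d ^+ 3 = (3 * (x * d ^+ 2)) * (4 * x * d) by ring.
rewrite ler_wpM2r //; first by rewrite !mulr_ge0 //; lra.
have -> : 2 * x * d * d = 2 * (x * d ^+ 2) by ring.
lra.
Qed.

(** * The lower bound and the limit *)

Lemma covering_ratios_ge_half (R : realType) n (g : R) : (0 < n)%N ->
  covering_ratios (2 ^ n) (simplex R n) g -> 1 / 2 <= g.
Proof.
move=> n0 [g0 [c cov]]; rewrite leNgt; apply/negP => g12.
have g2 : 0 < 1 - 2 * g by lra.
(* This makes [2 * g * N + n < N], so that [2 * G + n < N] after rounding down. *)
pose N := Num.bound (n%:R / (1 - 2 * g)).
have NP : n%:R / (1 - 2 * g) < N%:R by apply: archi_boundP; rewrite divr_ge0 // ltW.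
rewrite ltr_pdivrMr // in NP.
have N0 : 0 < N%:R :> R.
  by rewrite -(pmulr_lgt0 _ g2); apply: le_lt_trans NP.
pose G := Num.truncn (g * N%:R).
have /andP[G1 G2] : G%:R <= g * N%:R < G.+1%:R by rewrite truncn_itv // mulr_ge0 // ltW.
have GN : (2 * G + n < N)%N.
  rewrite -(ltr_nat R) natrD natrM; move: NP G1; rewrite mulrBr mulr1; lra.
pose x (t : n.-tuple 'I_N.+1) : 'rV[R]_n := \row_k ((tnth t k)%:R / N%:R).
pose F i : {set n.-tuple 'I_N.+1} := [set t | `[< homothet (c i) g (simplex R n) (x t) >]]%SET.
have cF i : (#|F i| <= 'C(n + G, n))%N.
  (* Scaled by [N], the homothet becomes a simplex of size [g * N < G.+1] with corner
     [N%:R * c i]. *)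
  apply: (@card_lattice_translate R _ _ _ (fun k => N%:R * c i ord0 k)) => t.
    move=> k; rewrite inE => /asboolP[z [z0 z1] /rowP /(_ k)]; rewrite !mxE => e.
    have := z0 k; move: e => /(congr1 (fun r => r * N%:R)); rewrite divfK ?gt_eqF // => <- zk.
    by rewrite mulrDl mulrC lerDl !mulr_ge0 // ltW.
  rewrite inE => /asboolP[z [z0 z1] e]; apply: le_lt_trans G2.
  have -> : \sum_k ((tnth t k)%:R - N%:R * c i ord0 k) = (g * N%:R) * \sum_k z ord0 k.
    rewrite mulr_sumr; apply: eq_bigr => k _.
    move: e => /rowP /(_ k); rewrite !mxE => /(congr1 (fun r => r * N%:R)).
    by rewrite divfK ?gt_eqF // => <-; ring.
  by rewrite ler_piMr // mulr_ge0 // ltW.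
have [t tN tF] := exists_uncovered_tuple n0 GN cF.
have /cov[i _ xi] : simplex R n (x t).
  split=> [k|]; first by rewrite mxE divr_ge0.
  under eq_bigr do rewrite mxE.
  by rewrite -mulr_suml ler_pdivrMr // mul1r -natr_sum ler_nat.
by move: (tF i); rewrite inE => /asboolP.
Qed.

Lemma has_lbound_covering_ratios (R : realType) n m (K : set 'rV[R]_n) :
  has_lbound (covering_ratios m K).
Proof. by exists 0 => g [/ltW]. Qed.

Theorem theorem1p1 (R : realType) :
  (forall g : R, 1 / 2 < g ->
     \forall n \near \oo, Gamma (2 ^ n) (simplex R n) <= g) /\
  (Gamma (2 ^ n) (simplex R n) @[n --> \oo] --> (1 / 2 : R)).
Proof.
have upper (g : R) : 1 / 2 < g -> \forall n \near \oo, Gamma (2 ^ n) (simplex R n) <= g.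
  move=> /covering_ratios_near; apply: filterS => n.
  exact/ge_inf/has_lbound_covering_ratios.
split=> //; apply/cvgrPdist_le => e e0.
have h1 : 1 / 2 < 1 / 2 + e by lra.
have h2 := upper _ h1; have h3 := covering_ratios_near h1.
near=> n.
have lower : 1 / 2 <= Gamma (2 ^ n) (simplex R n).
  (* The infimum of an empty set would be the default 0; the upper bound supplies a member. *)
  apply: lb_le_inf; first by exists (1 / 2 + e); near: n.
  by move=> g; apply: covering_ratios_ge_half; near: n; exact: nbhs_infty_gt.
have le_g : Gamma (2 ^ n) (simplex R n) <= 1 / 2 + e by near: n.
by rewrite ler0_norm; lra.
Unshelve. all: by end_near.
Qed.
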